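(* Let $p$ be a prime, let $g(t)\in\mathbb{Z}_p[t,t^{-1}]$, and let $X=\mathbb{Z}_p[t,t^{-1}]/(g(t))$, regarded as an Alexander quandle. Let $n$ be a positive integer, and let $a_i=p^{m_i}$ for $i=1,\ldots,n-1$, where the $m_i$ are non-negative integers. Let $f:X^n\to X$ be defined by $$f(x_1,x_2,\ldots,x_n)=(x_1-x_2)^{a_1}(x_2-x_3)^{a_2}\cdots(x_{n-1}-x_n)^{a_{n-1}}x_n^{a_n}.$$ 1. If $a_n=0$, then $f$ is a quandle $n$-cocycle, i.e. $f\in Z^n_{\rm Q}(X;X)$. 2. If $a_n=p^{m_n}$ for a positive integer $m_n$, then $f$ is a quandle $n$-cocycle (i.e. $f\in Z^n_{\rm Q}(X;X)$) if $g(t)$ divides $1-t^a$ in $\mathbb{Z}_p[t,t^{-1}]$, where $a=a_1+a_2+\cdots+a_{n-1}+a_n$.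
   Context: $\mathbb{Z}_p=\mathbb{Z}/p\mathbb{Z}$. A quandle is a set $X$ with a binary operation $*$ such that $a*a=a$; for all $a,b$ there is a unique $c$ with $a=c*b$; and $(a*b)*c=(a*c)*(b*c)$. Any $\mathbb{Z}[t,t^{-1}]$-module $M$ is a quandle (Alexander quandle) under $a*b=ta+(1-t)b$. The convention $x^0=1$ is used for all $x\in X$. Quandle cocycles: for a quandle $X$ let $C_n^R(X)$ be the free abelian group on $X^n$, with boundary $$\partial_n(x_1,\ldots,x_n)=\sum_{i=2}^n(-1)^i\big[(x_1,\ldots,x_{i-1},x_{i+1},\ldots,x_n)-(x_1*x_i,\ldots,x_{i-1}*x_i,x_{i+1},\ldots,x_n)\big]$$ for $n\ge 2$ and $\partial_n=0$ for $n\le 1$. Let $C_n^D(X)\subset C_n^R(X)$ be the subgroup generated by tuples with $x_i=x_{i+1}$ for some $i\in\{1,\ldots,n-1\}$ if $n\geq 2$, and $C_n^D(X)=0$ otherwise; it is a subcomplex. Set $C_n^Q(X)=C_n^R(X)/C_n^D(X)$ with the induced boundary. For an abelian group $A$, $C_Q^n(X;A)=\mathrm{Hom}(C_n^Q(X),A)$ with coboundary $\delta f=f\circ\partial$; $Z_{\rm Q}^n(X;A)=\ker\delta\subset C^n_Q(X;A)$ is the group of quandle $n$-cocycles. Thus a function $f:X^n\to A$, extended linearly, is an $n$-cocycle iff it vanishes on all $n$-tuples with $x_i=x_{i+1}$ for some $i$ and satisfies $f\circ\partial_{n+1}=0$. Here $A=X$ with its additive group structure. *)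

(* Defs.v *)
From HB Require Import structures.
From mathcomp Require Import all_boot all_order all_algebra.
From mathcomp Require Import generic_quotient ring_quotient fraction boolp.
From mathcomp.multinomials Require Import freeg.
From mathcomp Require Import zify.

Set Implicit Arguments.
Unset Strict Implicit.
Unset Printing Implicit Defensive.

Import GRing.Theory.
Local Open Scope ring_scope.
Local Open Scope quotient_scope.

(* R[t, t^-1] is the subring of the field of fractions of R[X] made of the
   q / X^n. *)
Section Laurent.
Variable R : idomainType.

Definition laurent_pred : {pred {fraction {poly R}}} :=
  fun x => `[< exists (q : {poly R}) (n : nat), x = tofrac q / tofrac 'X ^+ n >].

Lemma tofracX_neq0 : tofrac 'X != 0 :> {fraction {poly R}}.
Proof. by rewrite tofrac_eq0 polyX_eq0. Qed.

Lemma laurent_subring_closed : subring_closed laurent_pred.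
Proof.
have nX n : tofrac 'X ^+ n != 0 :> {fraction {poly R}}.
  by rewrite expf_neq0 // tofracX_neq0.
split=> [|_ _ /asboolP[q [n ->]] /asboolP[r [k ->]]
         |_ _ /asboolP[q [n ->]] /asboolP[r [k ->]]]; apply/asboolP.
- by exists 1, 0%N; rewrite expr0 divr1 rmorph1.
- exists (q * 'X^k - r * 'X^n), (n + k)%N.
  by rewrite -[in LHS]mulNr addf_div ?nX // tofracB !tofracM !tofracXn mulNr exprD.
- by exists (q * r), (n + k)%N; rewrite mulf_div -tofracM exprD.
Qed.

HB.instance Definition _ := GRing.isSubringClosed.Build _ laurent_pred
  laurent_subring_closed.

Record laurent := Laurent { laurent_val; _ : laurent_val \in laurent_pred }.

HB.instance Definition _ := [isSub for laurent_val].
HB.instance Definition _ := [Choice of laurent by <:].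
HB.instance Definition _ := [SubChoice_isSubComNzRing of laurent by <:].

Lemma laurent_t_subproof : tofrac 'X \in laurent_pred.
Proof. by apply/asboolP; exists 'X, 0%N; rewrite expr0 divr1. Qed.

Lemma laurent_tinv_subproof : (tofrac 'X)^-1 \in laurent_pred.
Proof. by apply/asboolP; exists 1, 1%N; rewrite rmorph1 mul1r. Qed.

Definition laurent_t : laurent := Laurent laurent_t_subproof.
Definition laurent_tinv : laurent := Laurent laurent_tinv_subproof.

Lemma laurent_tVt : laurent_tinv * laurent_t = 1.
Proof. by apply: val_inj; rewrite /= mulVf // tofracX_neq0. Qed.

End Laurent.

Notation "{ 'laurent' R }" := (laurent R) (format "{ 'laurent'  R }") : type_scope.

(* The quotient of a commutative ring by a principal ideal.  The ring structure
   that the library puts on quotients is restricted to proper ideals, whereas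
   here g may be a unit, in which case the quotient is the zero ring. *)
Section PrincipalQuotient.
Variables (R : comNzRingType) (g : R).

Definition divides (h : R) : Prop := exists q, h = q * g.

Definition principal_ideal : {pred R} := fun h => `[< divides h >].

Lemma principal_ideal_zmod_closed : zmod_closed principal_ideal.
Proof.
split=> [|_ _ /asboolP[q ->] /asboolP[r ->]]; apply/asboolP.
  by exists 0; rewrite mul0r.
by exists (q - r); rewrite mulrBl.
Qed.

HB.instance Definition _ := GRing.isZmodClosed.Build R principal_ideal
  principal_ideal_zmod_closed.

Definition pquot : Type := {ideal_quot principal_ideal}.

HB.instance Definition _ := GRing.Zmodule.on pquot.
HB.instance Definition _ := Quotient.on pquot.

Definition pquot_pi (a : R) : pquot := \pi_pquot a.

Definition pquot_one : pquot := pquot_pi 1.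
Definition pquot_mul (x y : pquot) : pquot := pquot_pi (repr x * repr y).

Lemma pquot_piE (a b : R) : pquot_pi a = pquot_pi b <-> divides (a - b).
Proof.
split=> [/eqP|ab]; last apply/eqP;
  rewrite -[_ == _]/(a == b %[mod {ideal_quot principal_ideal}])
    -Quotient.idealrBE.
  by move/asboolP.
exact/asboolP.
Qed.

Lemma pquot_piK (x : pquot) : pquot_pi (repr x) = x.
Proof. exact: reprK. Qed.

Lemma pquot_pi_is_zmod_morphism : zmod_morphism pquot_pi.
Proof. exact: (raddfB (\pi_({ideal_quot principal_ideal}))). Qed.

HB.instance Definition _ := GRing.isZmodMorphism.Build R pquot pquot_pi
  pquot_pi_is_zmod_morphism.

Lemma pquot_piM : {morph pquot_pi : a b / a * b >-> pquot_mul a b}.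
Proof.
move=> a b; apply/pquot_piE.
have /pquot_piE[q aE] := esym (pquot_piK (pquot_pi a)).
have /pquot_piE[r bE] := esym (pquot_piK (pquot_pi b)).
exists (q * b + repr (pquot_pi a) * r).
by rewrite mulrDl -(mulrA _ r) -bE mulrAC -aE mulrBl mulrBr addrA subrK.
Qed.

Lemma pquot_mulA : associative pquot_mul.
Proof.
move=> x y z; rewrite -[x]pquot_piK -[y]pquot_piK -[z]pquot_piK.
by rewrite -!pquot_piM mulrA.
Qed.

Lemma pquot_mulC : commutative pquot_mul.
Proof. by move=> x y; rewrite /pquot_mul mulrC. Qed.

Lemma pquot_mul1 : left_id pquot_one pquot_mul.
Proof. by move=> x; rewrite -[x]pquot_piK -pquot_piM mul1r. Qed.

Lemma pquot_mulDl : left_distributive pquot_mul +%R.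
Proof.
move=> x y z; rewrite -[x]pquot_piK -[y]pquot_piK -[z]pquot_piK.
by rewrite -raddfD -!pquot_piM -raddfD mulrDl.
Qed.

HB.instance Definition _ := GRing.Zmodule_isComPzRing.Build pquot
  pquot_mulA pquot_mulC pquot_mul1 pquot_mulDl.

Lemma pquot_pi_is_monoid_morphism : monoid_morphism pquot_pi.
Proof. by split=> //; exact: pquot_piM. Qed.

HB.instance Definition _ := GRing.isMonoidMorphism.Build R pquot pquot_pi
  pquot_pi_is_monoid_morphism.

Definition pquot_scale (a : R) (x : pquot) : pquot := pquot_pi a * x.

Lemma pquot_scaleA a b x :
  pquot_scale a (pquot_scale b x) = pquot_scale (a * b) x.
Proof. by rewrite /pquot_scale rmorphM mulrA. Qed.

Lemma pquot_scale1 : left_id 1 pquot_scale.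
Proof. by move=> x; rewrite /pquot_scale rmorph1 mul1r. Qed.

Lemma pquot_scaleDr : right_distributive pquot_scale +%R.
Proof. by move=> a x y; rewrite /pquot_scale mulrDr. Qed.

Lemma pquot_scaleDl x : {morph pquot_scale^~ x : a b / a + b}.
Proof. by move=> a b; rewrite /pquot_scale rmorphD mulrDl. Qed.

HB.instance Definition _ := GRing.Zmodule_isLmodule.Build R pquot
  pquot_scaleA pquot_scale1 pquot_scaleDr pquot_scaleDl.

End PrincipalQuotient.

Structure quandle := Quandle {
  quandle_sort :> choiceType;
  qop : quandle_sort -> quandle_sort -> quandle_sort;
  qopxx : forall a, qop a a = a;
  qop_div : forall a b, exists! c, a = qop c b;
  qop_distr : forall a b c, qop (qop a b) c = qop (qop a c) (qop b c)
}.

(* For R = int these are the Z[t, t^-1]-modules; a module over R[t, t^-1]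
   restricts to one over Z[t, t^-1], with the same operation. *)
Section Alexander.
Variables (R : idomainType) (M : lmodType {laurent R}).

Local Notation t := (laurent_t R).

Definition alexander_op (a b : M) : M := t *: a + (1 - t) *: b.

Lemma alexander_opxx a : alexander_op a a = a.
Proof. by rewrite /alexander_op -scalerDl addrC subrK scale1r. Qed.

Lemma alexander_op_div a b : exists! c, a = alexander_op c b.
Proof.
have tV : laurent_tinv R * t = 1 := laurent_tVt R.
exists (laurent_tinv R *: (a - (1 - t) *: b)); split.
  by rewrite /alexander_op scalerA mulrC tV scale1r subrK.
by move=> c ->; rewrite addrK scalerA tV scale1r.
Qed.

Lemma alexander_op_distr a b c :
  alexander_op (alexander_op a b) c =
  alexander_op (alexander_op a c) (alexander_op b c).
Proof.
rewrite /alexander_op !scalerDr !scalerA (mulrC (1 - t) t) [RHS]addrACA.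
by congr (_ + _); rewrite -scalerDl -mulrDl [t + _]addrC subrK mul1r.
Qed.

Definition alexander : quandle :=
  Quandle alexander_opxx alexander_op_div alexander_op_distr.

End Alexander.

Section QuandleCohomology.
Variable X : quandle.

Definition rack_chain (n : nat) : Type := {freeg (n.-tuple X) / int}.
HB.instance Definition _ n := GRing.Lmodule.on (rack_chain n).

(* Tuples are 0-based: the 1-based index i of the usual formula for the boundary
   is j.+1 below, so that i >= 2 reads 0 < j. *)
Definition face0 n (j : 'I_n.+1) (x : n.+1.-tuple X) : n.-tuple X :=
  [tuple tnth x (fintype.lift j k) | k < n].

Definition face1 n (j : 'I_n.+1) (x : n.+1.-tuple X) : n.-tuple X :=
  [tuple if (k < j)%N then qop (tnth x (fintype.lift j k)) (tnth x j)
         else tnth x (fintype.lift j k) | k < n].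

Definition boundary_gen n (x : n.+1.-tuple X) : rack_chain n :=
  \sum_(j < n.+1 | (0 < j)%N)
     (-1) ^+ j.+1 *: (<< face0 j x >> - << face1 j x >>).

(* The boundary from degree n + 1 to degree n; for n = 0 the sum is empty. *)
Definition boundary n : rack_chain n.+1 -> rack_chain n :=
  fglift (@boundary_gen n).

Definition degenerate n (x : n.-tuple X) : bool :=
  [exists i : 'I_n, exists j : 'I_n, (j == i.+1 :> nat) && (tnth x i == tnth x j)].

Definition degenerate_chain n : {pred rack_chain n} :=
  fun c => `[< exists2 s : seq (int * n.-tuple X),
                 all (fun kx => degenerate kx.2) s
               & c = \sum_(kx <- s) kx.1 *: << kx.2 >> >].

Lemma degenerate_chain_zmod_closed n : zmod_closed (@degenerate_chain n).
Proof.
split=> [|_ _ /asboolP[s sD ->] /asboolP[r rD ->]]; apply/asboolP.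
  by exists [::] => //; rewrite big_nil.
exists (s ++ [seq (- kx.1, kx.2) | kx <- r]).
  by rewrite all_cat sD all_map.
rewrite big_cat big_map /= -sumrN; congr (_ + _).
by apply: eq_bigr => kx _; rewrite scaleNr.
Qed.

HB.instance Definition _ n := GRing.isZmodClosed.Build (rack_chain n)
  (@degenerate_chain n) (@degenerate_chain_zmod_closed n).

Definition quandle_chain n : Type := {ideal_quot (@degenerate_chain n)}.
HB.instance Definition _ n := GRing.Zmodule.on (quandle_chain n).
HB.instance Definition _ n := Quotient.on (quandle_chain n).

Definition quandle_pi n (c : rack_chain n) : quandle_chain n :=
  \pi_(quandle_chain n) c.

Lemma quandle_pi_is_zmod_morphism n : zmod_morphism (@quandle_pi n).
Proof. exact: (raddfB (\pi_({ideal_quot (@degenerate_chain n)}))). Qed.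

HB.instance Definition _ n := GRing.isZmodMorphism.Build
  (rack_chain n) (quandle_chain n) (@quandle_pi n)
  (@quandle_pi_is_zmod_morphism n).

Lemma quandle_pi_eq0 n (c : rack_chain n) :
  (quandle_pi c == 0) = (c \in @degenerate_chain n).
Proof.
rewrite -(raddf0 (@quandle_pi n)).
rewrite -[LHS]/(c == 0 %[mod {ideal_quot (@degenerate_chain n)}]).
by rewrite -Quotient.idealrBE subr0.
Qed.

Lemma quandle_piK n (c : quandle_chain n) : quandle_pi (repr c) = c.
Proof. exact: reprK. Qed.

Lemma boundary_is_zmod_morphism n : zmod_morphism (@boundary n).
Proof. exact: lift_is_additive. Qed.

HB.instance Definition _ n := GRing.isZmodMorphism.Build
  (rack_chain n.+1) (rack_chain n) (@boundary n)
  (@boundary_is_zmod_morphism n).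

Lemma degenerateP n (x : n.-tuple X) x0 :
  reflect (exists2 k, (k.+1 < n)%N & nth x0 x k = nth x0 x k.+1) (degenerate x).
Proof.
apply: (iffP existsP) => [[i /existsP[j /andP[/eqP ji /eqP]]]|[k kn xk]].
  rewrite !(tnth_nth x0) ji => xij; exists (val i) => //.
  by rewrite -ji ltn_ord.
exists (Ordinal (ltnW kn)); apply/existsP; exists (Ordinal kn).
by rewrite /= eqxx /= !(tnth_nth x0) /= xk.
Qed.

Lemma nth_face0 n (j : 'I_n.+1) (x : n.+1.-tuple X) x0 k : (k < n)%N ->
  nth x0 (face0 j x) k = nth x0 x (bump j k).
Proof.
move=> kn; rewrite -[k]/(val (Ordinal kn)) -(tnth_nth x0 (face0 j x)).
by rewrite tnth_mktuple (tnth_nth x0).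
Qed.

Lemma nth_face1 n (j : 'I_n.+1) (x : n.+1.-tuple X) x0 k : (k < n)%N ->
  nth x0 (face1 j x) k =
  if (k < j)%N then qop (nth x0 x (bump j k)) (nth x0 x j)
  else nth x0 x (bump j k).
Proof.
move=> kn; rewrite -[k]/(val (Ordinal kn)) -(tnth_nth x0 (face1 j x)).
by rewrite tnth_mktuple !(tnth_nth x0).
Qed.

Lemma face_degenerate n (j : 'I_n.+1) (x : n.+1.-tuple X) x0 i :
    (i.+1 < n.+1)%N -> nth x0 x i = nth x0 x i.+1 ->
    j != i :> nat -> j != i.+1 :> nat ->
  degenerate (face0 j x) /\ degenerate (face1 j x).
Proof.
move=> lt_in xi ji ji1; have jn := ltn_ord j.
have [k [kn bk bk1 ltk]] : exists k, [/\ (k.+1 < n)%N, bump j k = i,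
    bump j k.+1 = i.+1 & (k < j)%N = (k.+1 < j)%N].
  rewrite /bump; case: (ltnP j i) => [lt_ji|le_ij].
    by exists i.-1; split; lia.
  by exists i; split; lia.
split; apply/(degenerateP _ x0); exists k => //.
  by rewrite !nth_face0 ?bk ?bk1 // ltnW.
by rewrite !nth_face1 ?bk ?bk1 ?ltk ?xi // ltnW.
Qed.

Lemma degenerate_chainU n (x : n.-tuple X) :
  degenerate x -> (<< x >> : rack_chain n) \in @degenerate_chain n.
Proof.
move=> xD; apply/asboolP; exists [:: (1, x)]; first by rewrite /= xD.
by rewrite big_seq1 scale1r.
Qed.

Lemma degenerate_chainZ n (k : int) (c : rack_chain n) :
  c \in @degenerate_chain n -> k *: c \in @degenerate_chain n.
Proof. by move=> cD; rewrite -[k]intz scaler_int rpredMz. Qed.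

Lemma boundary_gen_degenerate n (x : n.+1.-tuple X) :
  degenerate x -> boundary_gen x \in @degenerate_chain n.
Proof.
have x0 := thead x; move=> /(degenerateP _ x0)[i lt_in xi].
have DF (j : 'I_n.+1) : j != i :> nat -> j != i.+1 :> nat ->
    (-1) ^+ j.+1 *: (<< face0 j x >> - << face1 j x >>) \in @degenerate_chain n.
  move=> ji ji1; have [d0 d1] := face_degenerate lt_in xi ji ji1.
  by apply: degenerate_chainZ; rewrite rpredB ?degenerate_chainU.
pose i0 := Ordinal (ltnW lt_in); pose i1 := Ordinal lt_in.
have face0E : face0 i0 x = face0 i1 x.
  apply: val_inj; apply: (@eq_from_nth _ x0) => [|k]; rewrite !size_tuple // => kn.
  rewrite !nth_face0 //= /bump.
  by have [ik|ki|<-] := ltngtP i k => //; rewrite add1n add0n.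
have face1E : face1 i0 x = face1 i1 x.
  apply: val_inj; apply: (@eq_from_nth _ x0) => [|k]; rewrite !size_tuple // => kn.
  rewrite !nth_face1 //= /bump ltnS xi.
  by have [ik|ki|<-] := ltngtP i k => //; rewrite add1n add0n xi qopxx.
rewrite /boundary_gen (bigD1 i1) //=.
have [i_gt0|i_le0] := ltnP 0 i.
  rewrite (bigD1 i0) ?i_gt0 ?neq_ltn /= ?ltnSn // addrA.
  rewrite face0E face1E -scalerDl [(-1) ^+ i.+2]exprS mulN1r addNr.
  rewrite scale0r add0r.
  by apply: rpred_sum => j /andP[/andP[_ ji1] ji0]; apply: DF.
suff -> : face0 i1 x = face1 i1 x.
  rewrite subrr scaler0 add0r.
  by apply: rpred_sum => j /andP[j_gt0 ji1]; apply: DF => //; lia.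
rewrite -face0E -face1E.
apply: val_inj; apply: (@eq_from_nth _ x0) => [|k]; rewrite !size_tuple // => kn.
rewrite nth_face0 // nth_face1 //= ifF //; lia.
Qed.

Lemma boundary_degenerate n (c : rack_chain n.+1) :
  c \in @degenerate_chain n.+1 -> boundary c \in @degenerate_chain n.
Proof.
move=> /asboolP[s /allP sD ->]; rewrite raddf_sum big_seq.
apply: rpred_sum => -[k x] /sD /= xD.
rewrite -[k]intz scaler_int raddfMz rpredMz //= /boundary liftU scale1r.
exact: boundary_gen_degenerate.
Qed.

Definition quandle_boundary n (c : quandle_chain n.+1) : quandle_chain n :=
  quandle_pi (boundary (repr c)).

Lemma quandle_boundary_pi n (c : rack_chain n.+1) :
  quandle_boundary (quandle_pi c) = quandle_pi (boundary c).
Proof.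
apply/eqP; rewrite -subr_eq0 -!raddfB quandle_pi_eq0 boundary_degenerate //.
by rewrite -quandle_pi_eq0 raddfB /= quandle_piK subrr.
Qed.

Lemma quandle_boundary_is_zmod_morphism n : zmod_morphism (@quandle_boundary n).
Proof.
move=> c d; rewrite -[c]quandle_piK -[d]quandle_piK -raddfB.
by rewrite !quandle_boundary_pi !raddfB.
Qed.

HB.instance Definition _ n := GRing.isZmodMorphism.Build
  (quandle_chain n.+1) (quandle_chain n) (@quandle_boundary n)
  (@quandle_boundary_is_zmod_morphism n).

Definition quandle_cochain n (A : zmodType) := {additive quandle_chain n -> A}.

Definition coboundary n (A : zmodType) (phi : quandle_cochain n A) :
    quandle_cochain n.+1 A :=
  phi \o @quandle_boundary n.

(* f is identified with its linear extension, an element of Hom(C_n^Q, A). *)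
Definition quandle_cocycle n (A : zmodType) (f : n.-tuple X -> A) : Prop :=
  exists phi : quandle_cochain n A,
    (forall x, phi (quandle_pi << x >>) = f x) /\ coboundary phi =1 \0.

End QuandleCohomology.

(* The exponents a_1, ..., a_(n-1) are a 0, ..., a (n - 2), and b is a_n. *)
Definition diff_monomial (X : comPzRingType) n (a : 'I_n.-1 -> nat) (b : nat)
    (x : n.-tuple X) : X :=
  (\prod_(i < n.-1) (x`_i - x`_i.+1) ^+ a i) * x`_n.-1 ^+ b.

(* Main.v *)
From HB Require Import structures.
Require Import Defs.
From mathcomp Require Import all_boot all_algebra.
From mathcomp Require Import boolp ring zify.
From mathcomp.multinomials Require Import freeg.

Set Implicit Arguments.
Unset Strict Implicit.
Unset Printing Implicit Defensive.

Import GRing.Theory.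
Local Open Scope ring_scope.

(** Write y_i = x_i - x_(i+1) for a point x of X^(n+1), and N = n - 1, with
    indices counted from 0.  In the quotient ring, where p = 0, raising to the
    power a_i = p^(m_i) is additive, and it takes t y to t^(a_i) y^(a_i).

    Deleting x_(k+1) merges y_k and y_(k+1) into their sum; the other face also
    acts on the entries on the left, which turns y_i into t y_i for i < k and
    merges y_k and y_(k+1) into t y_k + y_(k+1).  By additivity the product of
    the powered differences splits into two products, each omitting one of the
    n differences: with P_k the product that omits y_k and S_k the power of t
    with exponent a_0 + ... + a_(k-1), the face gives
    S_(k+1) P_(k+1) + S_k P_k ([diff_prod_face]).  The face that only deletes is
    the case t = 1 of this formula, so the difference of the two faces is
    Q_(k+1) + Q_k where Q_k = (1 - S_k) P_k, times the last factor h, which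
    these faces evaluate at the last entry.  The alternating sum of these terms
    telescopes to the two ends; Q_0 = 0 because S_0 = 1, and what is left is
    (1 - S_N) P_N h(v), up to sign, with v the last entry.

    The face at the last entry contributes P_N (h(u) - S_N h(t u + (1 - t) v)),
    up to sign, with u the next to last entry.  So everything cancels if
      S_N h(t u + (1 - t) v) = h(u) - (1 - S_N) h(v),
    the hypothesis of [monomial_boundary].  It is trivial for h = 1.  For
    h(u) = u^(p^m) additivity reduces it to S_N t^(p^m) = 1, which is what the
    divisibility of 1 - t^a by g gives in the quotient ([affine_scaling]). *)

(** * Cocycles as functions on tuples *)

Lemma additive_scalez (U : lmodType int) (W : zmodType)
  (phi : {additive U -> W}) k u : phi (k *: u) = phi u *~ k.
Proof. by rewrite -[k]intz scaler_int raddfMz intz. Qed.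

Section CocycleCriterion.
Variables (X : quandle) (n : nat) (A : zmodType) (f : n.-tuple X -> A).

(** The linear extension of f to rack chains; [zmodule A] is A seen as a module
    over the integers, which the universal property of free modules needs. *)
Definition chain_lift (c : rack_chain X n) : A := fglift (f : _ -> zmodule A) c.

Lemma chain_lift_is_zmod_morphism : zmod_morphism chain_lift.
Proof. exact: (@lift_is_additive _ _ (zmodule A) f). Qed.

HB.instance Definition _ := GRing.isZmodMorphism.Build (rack_chain X n) A
  chain_lift chain_lift_is_zmod_morphism.

Lemma chain_liftU x : chain_lift << x >> = f x.
Proof. by rewrite /chain_lift liftU scale1r. Qed.

Hypothesis f_degenerate : forall x, degenerate x -> f x = 0.

Lemma chain_lift_degenerate c : c \in @degenerate_chain X n -> chain_lift c = 0.
Proof.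
move=> /asboolP[s /allP sD ->]; rewrite raddf_sum big_seq big1 // => -[k x].
by move=> /sD /= xD; rewrite additive_scalez /= chain_liftU f_degenerate ?mul0rz.
Qed.

Definition quandle_lift (c : quandle_chain X n) : A := chain_lift (repr c).

Lemma quandle_lift_pi c : quandle_lift (quandle_pi c) = chain_lift c.
Proof.
apply/eqP; rewrite -subr_eq0 -raddfB /= chain_lift_degenerate //.
by rewrite -quandle_pi_eq0 raddfB /= quandle_piK subrr.
Qed.

Lemma quandle_lift_is_zmod_morphism : zmod_morphism quandle_lift.
Proof.
move=> c d; rewrite -[c]quandle_piK -[d]quandle_piK -raddfB.
by rewrite !quandle_lift_pi raddfB.
Qed.

HB.instance Definition _ := GRing.isZmodMorphism.Build (quandle_chain X n) A
  quandle_lift quandle_lift_is_zmod_morphism.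

(** It suffices to test the coboundary on generators: every quandle chain is the
    class of a rack chain, and rack chains are sums of multiples of tuples. *)
Lemma quandle_cocycle_criterion :
    (forall x : n.+1.-tuple X,
       \sum_(j < n.+1 | (0 < j)%N)
          (f (face0 j x) - f (face1 j x)) *~ (-1) ^+ j.+1 = 0) ->
  quandle_cocycle f.
Proof.
move=> fB; exists (quandle_lift : {additive _ -> _}); split=> [x|c].
  by rewrite /= quandle_lift_pi chain_liftU.
rewrite -[c]quandle_piK /coboundary /= quandle_boundary_pi quandle_lift_pi.
elim/freeg_ind_dom0: (repr c) => [|k x D _ _ IH]; first by rewrite !raddf0.
rewrite !raddfD /= {}IH addr0 {1}/boundary liftU additive_scalez /=.
rewrite -[RHS](mul0rz _ k) -(fB x); congr (_ *~ _).
rewrite raddf_sum; apply: eq_bigr => j _.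
by rewrite additive_scalez raddfB /= !chain_liftU.
Qed.

End CocycleCriterion.

(** * The telescoping identity *)

Section Telescoping.
Variables (A : comPzRingType) (N : nat) (e : 'I_N -> nat).
Hypothesis powD : forall i (u v : A), (u + v) ^+ e i = u ^+ e i + v ^+ e i.
Implicit Types (t : A) (x : nat -> A).

Definition diff_prod x : A := \prod_(i < N) (x i - x i.+1) ^+ e i.

(** The differences of consecutive entries of x_0, ..., x_(N+1) are N + 1 in
    number; the k-th is left out, and the N others receive the N exponents in
    order. *)
Definition diff_prod_omit k x : A :=
  \prod_(i < N) (x (bump k i) - x (bump k i).+1) ^+ e i.

Definition partial_scaling t k : A := \prod_(i < N | (i < k)%N) t ^+ e i.

(** The face at j of the sequence x for the operation t u + (1 - t) v.  Since
    this operation is the first projection for t = 1, the face that only deletes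
    x_j is [face_at 1 j x]. *)
Definition face_at t j x (k : nat) : A :=
  if (k < j)%N then t * x (bump j k) + (1 - t) * x j else x (bump j k).

(** Only the factor at k involves both y_k and y_(k+1), as the power of
    t y_k + y_(k+1), which splits by additivity.  The other differences come
    from one y_i each, scaled by t exactly when i < k. *)
Lemma diff_prod_face t x k : (k < N)%N ->
  diff_prod (face_at t k.+1 x) =
    partial_scaling t k.+1 * diff_prod_omit k.+1 x
    + partial_scaling t k * diff_prod_omit k x.
Proof.
move=> kN; pose i0 := Ordinal kN.
pose R := \prod_(i < N | i != i0) (x (bump k i) - x (bump k i).+1) ^+ e i.
have ordE (i : 'I_N) : (i != i0) = (i != k :> nat) by [].
have omitE : diff_prod_omit k x = (x k.+1 - x k.+2) ^+ e i0 * R.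
  by rewrite /diff_prod_omit (bigD1 i0) //= /bump leqnn.
have omitSE : diff_prod_omit k.+1 x = (x k - x k.+1) ^+ e i0 * R.
  rewrite /diff_prod_omit (bigD1 i0) //= {1 2}/bump ltnn; congr (_ * _).
  apply: eq_bigr => i; rewrite ordE => ik; suff -> : bump k.+1 i = bump k i by [].
  by rewrite /bump; lia.
have scalingSE : partial_scaling t k.+1 = t ^+ e i0 * partial_scaling t k.
  rewrite /partial_scaling (bigD1 i0) //=; congr (_ * _).
  by apply: eq_bigl => i; rewrite ordE; lia.
have restE : \prod_(i < N | i != i0)
    (face_at t k.+1 x i - face_at t k.+1 x i.+1) ^+ e i = partial_scaling t k * R.
  have -> : partial_scaling t k
            = \prod_(i < N | i != i0) (if (i < k)%N then t ^+ e i else 1).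
    by rewrite /partial_scaling big_mkcond (bigD1 i0) //= ltnn mul1r.
  rewrite -big_split; apply: eq_bigr => i /=; rewrite ordE => ik.
  rewrite /face_at !ltnS; case: (ltngtP i k) ik => // [lt_ik|lt_ki] _.
    have bumpE l j : (l < j)%N -> bump j l = l by rewrite /bump; lia.
    rewrite !bumpE ?ltnS ?(ltnW lt_ik) //.
    rewrite -exprMn; congr (_ ^+ _); ring.
  have bumpE l j : (j <= l)%N -> bump j l = l.+1 by rewrite /bump; lia.
  by rewrite !bumpE ?ltnS ?(ltnW lt_ki) ?(leqW (ltnW lt_ki)) // mul1r.
rewrite omitE omitSE scalingSE /diff_prod (bigD1 i0) //= restE.
have -> : face_at t k.+1 x k - face_at t k.+1 x k.+1
          = t * (x k - x k.+1) + (x k.+1 - x k.+2).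
  by rewrite /face_at /bump ltnSn !ltnn /= add0n add1n; ring.
rewrite (powD _ (t * _)) exprMn; ring.
Qed.

(** At the last entry nothing is merged: all differences that remain are scaled
    by t. *)
Lemma diff_prod_last_face t x :
  diff_prod (face_at t N.+1 x) = partial_scaling t N * diff_prod_omit N x.
Proof.
rewrite /partial_scaling big_mkcond /= -big_split; apply: eq_bigr => i _ /=.
have iN := ltn_ord i.
have bumpE j k : (k < j)%N -> bump j k = k by rewrite /bump; lia.
rewrite iN /face_at !ltnS iN (ltnW iN) !bumpE ?ltnS ?(ltnW iN) //.
rewrite -exprMn; congr (_ ^+ _); ring.
Qed.

Lemma partial_scaling1 k : partial_scaling 1 k = 1.
Proof. by rewrite /partial_scaling big1 // => i _; rewrite expr1n. Qed.

Lemma partial_scaling0 t : partial_scaling t 0 = 1.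
Proof. by rewrite /partial_scaling big_pred0. Qed.

Lemma partial_scaling_full t : partial_scaling t N = t ^+ (\sum_(i < N) e i).
Proof. by rewrite expr_sum; apply: eq_bigl => i; rewrite ltn_ord. Qed.

(** The last factor is kept abstract, so that the constant 1 and a power are
    treated together. *)
Variables (t : A) (h : A -> A).
Hypothesis h_scaling : forall u v,
  partial_scaling t N * h (t * u + (1 - t) * v)
  = h u - (1 - partial_scaling t N) * h v.

Definition monomial x : A := diff_prod x * h (x N).

(** The faces at 1, ..., N telescope to their end terms, and the scaling
    condition on h makes the face at N + 1 cancel the end term that is left. *)
Lemma monomial_boundary x :
  \sum_(j < N.+2 | (0 < j)%N)
     (monomial (face_at 1 j x) - monomial (face_at t j x)) *~ (-1) ^+ j.+1 = 0.
Proof.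
pose Q k := (1 - partial_scaling t k) * diff_prod_omit k x * h (x N.+1).
have face_lastE s j : (j <= N)%N -> face_at s j x N = x N.+1.
  by move=> jN; rewrite /face_at ltnNge jN /bump jN.
(* The face at 0 does not occur, so the face at j.+1 gets index j. *)
pose F j := (-1) ^+ j.+2 * (monomial (face_at 1 j.+1 x)
                            - monomial (face_at t j.+1 x)).
rewrite big_mkcond big_ord_recl /= add0r.
rewrite (eq_bigr (fun j : 'I_N.+1 => F j)) => [|j _]; last first.
  by rewrite -mulrzl intr_sign.
rewrite big_ord_recr -(big_mkord xpredT) /=.
rewrite (telescope_sumr_eq (fun k => - ((-1) ^+ k * Q k))) //; last first.
  move=> k /= kN; rewrite /F /monomial !diff_prod_face // !face_lastE //.
  by rewrite !partial_scaling1 /Q !exprS; ring.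
rewrite /F /monomial !diff_prod_last_face partial_scaling1 /Q partial_scaling0.
have lastE s : face_at s N.+1 x N = s * x N + (1 - s) * x N.+1.
  by rewrite /face_at ltnSn /bump ltnn.
rewrite !lastE.
have := h_scaling (x N) (x N.+1); set z := h (t * _ + _) => hz.
have -> : 1 * x N + (1 - 1) * x N.+1 = x N by ring.
have -> : partial_scaling t N * diff_prod_omit N x * z =
   diff_prod_omit N x * (partial_scaling t N * z) by ring.
by rewrite hz !exprS; ring.
Qed.

End Telescoping.

(** A monomial only reads the entries of its tuple, so tuples may be replaced by
    sequences agreeing with them in range. *)
Lemma diff_monomialE (A : comPzRingType) N (e : 'I_N -> nat) b
    (x : N.+1.-tuple A) (y : nat -> A) :
    (forall k, (k < N.+1)%N -> x`_k = y k) ->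
  diff_monomial (n := N.+1) e b x = monomial e (fun u => u ^+ b) y.
Proof.
move=> xy; rewrite /diff_monomial /monomial /= xy //; congr (_ * _).
apply: eq_bigr => i _; have iN := ltn_ord i.
by rewrite !xy // ltnW.
Qed.

Lemma diff_monomial_eq0 (A : comPzRingType) N (e : 'I_N -> nat) b
    (x : N.+1.-tuple A) k :
    (forall i, (0 < e i)%N) -> (k < N)%N -> x`_k = x`_k.+1 ->
  diff_monomial (n := N.+1) e b x = 0.
Proof.
move=> e_gt0 kN xk; rewrite /diff_monomial (bigD1 (Ordinal kN)) //= xk subrr.
by rewrite expr0n gtn_eqF ?e_gt0 // !mul0r.
Qed.

(** * Alexander quandles of Laurent polynomial quotients *)

Section AlexanderQuotient.
Variables (R : idomainType) (g : {laurent R}) (N : nat).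
Variables (e : 'I_N -> nat) (b : nat).

Local Notation A := (pquot g).
Local Notation t := (pquot_pi g (laurent_t R)).
Local Notation S := (t ^+ (\sum_(i < N) e i)).

Hypothesis e_gt0 : forall i, (0 < e i)%N.
Hypothesis powD : forall i (u v : A), (u + v) ^+ e i = u ^+ e i + v ^+ e i.
Hypothesis pow_scaling : forall u v : A,
  S * (t * u + (1 - t) * v) ^+ b = u ^+ b - (1 - S) * v ^+ b.

Lemma alexander_opE (u v : A) : alexander_op u v = t * u + (1 - t) * v.
Proof. by rewrite -(rmorph1 (pquot_pi g)) -(raddfB (pquot_pi g)). Qed.

Lemma alexander_cocycle :
  quandle_cocycle (X := alexander A) (A := A) (diff_monomial (n := N.+1) e b).
Proof.
apply: quandle_cocycle_criterion => [x|x].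
  case/(degenerateP _ (0 : alexander A)) => k.
  exact: (diff_monomial_eq0 (A := A) b e_gt0).
have pow_scaling' (u v : A) :
    partial_scaling e t N * (t * u + (1 - t) * v) ^+ b
    = u ^+ b - (1 - partial_scaling e t N) * v ^+ b.
  by rewrite partial_scaling_full.
have face0E j : diff_monomial (X := A) (n := N.+1) e b (face0 j x)
    = monomial e (fun u => u ^+ b) (face_at 1 j (nth 0 x)).
  apply: diff_monomialE => k kN.
  apply: etrans (nth_face0 j x (0 : alexander A) kN) _.
  by rewrite /face_at; case: ifP => // _; rewrite subrr mul0r addr0 mul1r.
have face1E j : diff_monomial (X := A) (n := N.+1) e b (face1 j x)
    = monomial e (fun u => u ^+ b) (face_at t j (nth 0 x)).
  apply: diff_monomialE => k kN.
  apply: etrans (nth_face1 j x (0 : alexander A) kN) _.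
  by rewrite /face_at /= alexander_opE.
have := monomial_boundary powD (h := fun u => u ^+ b) pow_scaling' (nth 0 x).
apply: etrans; apply: eq_bigr => j _.
exact: (congr2 (fun u v : A => (u - v) *~ (-1) ^+ j.+1) (face0E j) (face1E j)).
Qed.

End AlexanderQuotient.

(** When s is an inverse of t, this is the scaling condition of the telescoping
    identity for an additive last factor, u and v standing for its values. *)
Lemma affine_scaling (A : comPzRingType) (s t u v : A) :
  s * t = 1 -> s * (t * u + (1 - t) * v) = u - (1 - s) * v.
Proof. by move=> st; rewrite mulrDr !mulrA mulrBr st mulr1; ring. Qed.

Lemma laurent_pchar (p : nat) : prime p -> p \in [char {laurent 'F_p}].
Proof.
move=> p_prime; rewrite inE p_prime; apply/eqP; apply: val_inj.
have /(rmorph_pchar (@tofrac {poly 'F_p} \o polyC)) := pchar_Fp p_prime.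
by rewrite rmorph_nat rmorph0 => /pcharf0.
Qed.

(** The identity is proved in the Laurent ring and pushed to the quotient:
    when g is a unit the quotient is the zero ring, which has no
    characteristic in the usual sense. *)
Lemma pquot_frobeniusD (p : nat) (g : {laurent 'F_p}) k (u v : pquot g) :
  prime p -> (u + v) ^+ (p ^ k) = u ^+ (p ^ k) + v ^+ (p ^ k).
Proof.
move=> p_prime; rewrite -[u]pquot_piK -[v]pquot_piK.
rewrite -rmorphD -!rmorphXn -rmorphD exprDn_pchar // pnatX.
by rewrite pnatE // laurent_pchar.
Qed.

Theorem lemma2p1 (p : nat) (p_prime : prime p) (g : {laurent 'F_p})
    (n : nat) (n_gt0 : (0 < n)%N) (m : 'I_n.-1 -> nat) :
  let a := fun i => (p ^ m i)%N in
  let X := pquot g in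
  quandle_cocycle (X := alexander X) (A := X) (diff_monomial (X := X) a 0)
  /\
  (forall mn : nat, (0 < mn)%N ->
     divides g (1 - laurent_t 'F_p ^+ (\sum_(i < n.-1) a i + p ^ mn)%N) ->
     quandle_cocycle (X := alexander X) (A := X)
       (diff_monomial (X := X) a (p ^ mn)%N)).
Proof.
case: n n_gt0 m => // N _ m a X.
have a_gt0 i : (0 < a i)%N by rewrite expn_gt0 prime_gt0.
have powD i (u v : X) : (u + v) ^+ a i = u ^+ a i + v ^+ a i.
  exact: pquot_frobeniusD.
split=> [|mn _ g_dvd]; apply: alexander_cocycle => // u v.
  by rewrite !expr0 !mulr1 subKr.
have St : pquot_pi g (laurent_t 'F_p) ^+ (\sum_(i < N) a i)
    * pquot_pi g (laurent_t 'F_p) ^+ (p ^ mn) = 1.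
  rewrite -exprD -rmorphXn -(rmorph1 (pquot_pi g)).
  exact/esym/pquot_piE.
rewrite pquot_frobeniusD // !exprMn.
have -> : (1 - pquot_pi g (laurent_t 'F_p)) ^+ (p ^ mn)
   = 1 - pquot_pi g (laurent_t 'F_p) ^+ (p ^ mn).
  by apply/eqP; rewrite eq_sym subr_eq -pquot_frobeniusD // subrK expr1n.
exact: affine_scaling.
Qed.
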